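(* For any three positive masses $m_0=[m_1,m_2,m_3]$, the Lagrange equilateral triangle central configuration $$q_0=\left[1,\,0,\,-\tfrac12,\,\tfrac{\sqrt3}{2},\,-\tfrac12,\,-\tfrac{\sqrt3}{2}\right]$$ is nondegenerate.
   Context: A planar configuration of $N$ bodies is $q=(q_1,\dots,q_N)\in\mathbb{R}^{2N}$, $q_i=(x_i,y_i)^T\in\mathbb{R}^2$, written as $(x_1,y_1,\dots,x_N,y_N)^T$, with $q_i\ne q_j$ for $i\neq j$. For positive masses $m=(m_1,\dots,m_N)$ define $F(q,m)=[F_1,\dots,F_N]^T\in\mathbb{R}^{2N}$ by $$F_i(q,m)=\sum_{j\ne i}\frac{m_im_j(q_j-q_i)}{\|q_j-q_i\|^3}+\frac{U(q)}{I(q)}\,m_i(q_i-c),$$ where $U(q)=\sum_{i<j}\frac{m_im_j}{\|q_i-q_j\|}$, $I(q)=\sum_{i}m_i\|q_i-c\|^2$, $c=\frac{\sum_i m_iq_i}{\sum_i m_i}$. The configuration $q_0$ is a central configuration for $m_0$ if $F(q_0,m_0)=0$. Let $\mathrm{Jac}(F)|_{(q_0,m_0)}$ be the $2N\times 2N$ Jacobian of $F$ with respect to $q$ at $(q_0,m_0)$ (with $U,I,c$ regarded as functions of $q$). Nondegeneracy (Form IV): for a central configuration $q_0=(x_1,y_1,\dots,x_N,y_N)^T$ for $m_0$, let $B$ be the $2N\times4$ matrix whose columns are $(1,0,1,0,\dots,1,0)^T$, $(0,1,0,1,\dots,0,1)^T$, $(-y_1,x_1,\dots,-y_N,x_N)^T$,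 $(x_1,y_1,\dots,x_N,y_N)^T$ (translations, rotation, scaling), let $B_1$ be its first four rows and $B_2$ its remaining $2N-4$ rows, and let $P=\begin{bmatrix} B_1 & 0 \\ B_2 & \mathrm{Id} \end{bmatrix}$ with $\mathrm{Id}$ the identity of size $2N-4$ (this $P$ is invertible since $q_1\ne q_2$). Then $P^{-1}\mathrm{Jac}(F)|_{(q_0,m_0)}P=\begin{bmatrix} 0 & J_1 \\ 0 & J_2 \end{bmatrix}$ with $J_2$ of size $(2N-4)\times(2N-4)$. The central configuration $q_0$ is nondegenerate if $\det J_2\neq0$ and degenerate otherwise. Here $N=3$. *)

(* Defs.v *)
From HB Require Import structures.
From mathcomp Require Import all_boot all_order all_algebra.
From mathcomp Require Import all_classical all_reals all_analysis.
Set Implicit Arguments. Unset Strict Implicit. Unset Printing Implicit Defensive.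
Import Order.TTheory GRing.Theory Num.Theory.
Import numFieldNormedType.Exports.
Local Open Scope ring_scope.

(* R^2N is 'rV[R]_(N.*2), in the order x_1, y_1, ..., x_N, y_N. With bodies
   numbered from 0, coordinate a of body i has index 2i + a. *)

Lemma coord_index_subproof N (i : 'I_N) (a : 'I_2) : (i.*2 + a < N.*2)%N.
Proof.
apply: (@leq_trans i.+1.*2); last by rewrite leq_double.
by rewrite doubleS -addnS -[in leqRHS]addn2 leq_add2l ltn_ord.
Qed.

Definition coord_index N (i : 'I_N) (a : 'I_2) : 'I_(N.*2) :=
  Ordinal (coord_index_subproof i a).

Lemma body_index_subproof N (k : 'I_(N.*2)) : (k./2 < N)%N.
Proof. by rewrite ltn_half_double. Qed.

Definition body_index N (k : 'I_(N.*2)) : 'I_N := Ordinal (body_index_subproof k).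

Section PlanarNBody.
Variable R : realType.

Definition vec2 (x y : R) : 'rV[R]_2 := \row_(a < 2) [:: x; y]`_a.

(* The library norm on 'rV[R]_2 is the sup norm, hence this definition. *)
Definition enorm (v : 'rV[R]_2) : R := Num.sqrt (\sum_(a < 2) v 0 a ^+ 2).

Definition position N (q : 'rV[R]_(N.*2)) (i : 'I_N) : 'rV[R]_2 :=
  \row_(a < 2) q 0 (coord_index i a).

(* Inverse of position: lists the coordinates of v_1, ..., v_N in order. *)
Definition interleave N (v : 'I_N -> 'rV[R]_2) : 'rV[R]_(N.*2) :=
  \row_(k < N.*2) v (body_index k) 0 (inord (odd k)).

Section Equations.
Variables (N : nat) (m : 'rV[R]_N) (q : 'rV[R]_(N.*2)).
Local Notation pos := (position q).

Definition mass_center : 'rV[R]_2 :=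
  (\sum_(i < N) m 0 i)^-1 *: \sum_(i < N) m 0 i *: pos i.

Definition potential : R :=
  \sum_(i < N) \sum_(j < N | (i < j)%N) m 0 i * m 0 j / enorm (pos i - pos j).

Definition inertia : R := \sum_(i < N) m 0 i * enorm (pos i - mass_center) ^+ 2.

Definition cc_map_body (i : 'I_N) : 'rV[R]_2 :=
  \sum_(j < N | j != i)
     (m 0 i * m 0 j / enorm (pos j - pos i) ^+ 3) *: (pos j - pos i)
  + (potential / inertia * m 0 i) *: (pos i - mass_center).

Definition cc_map : 'rV[R]_(N.*2) := interleave cc_map_body.

Definition central_configuration : Prop :=
  (forall i j : 'I_N, i != j -> pos i != pos j) /\ cc_map = 0.

(* Columns: the two translations, the rotation and the scaling. *)
Definition symmetry_mx : 'M[R]_(N.*2, 4) :=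
  \matrix_(k < N.*2, c < 4)
    (nth 0 [:: interleave (fun=> vec2 1 0);
               interleave (fun=> vec2 0 1);
               interleave (fun i => vec2 (- pos i 0 1) (pos i 0 0));
               q] c) 0 k.

End Equations.

(* The library's jacobian acts on row vectors (h *m 'J f q is the differential
   applied to h); its transpose has entries dF_i / dq_j in row i, column j. *)
Definition cc_jacobian N (m : 'rV[R]_N) (q : 'rV[R]_(N.*2)) : 'M[R]_(N.*2) :=
  (jacobian (fun p => cc_map m p) q)^T.

Section Nondegeneracy.
(* N = n + 2, so that 2N = 4 + 2n holds by computation. *)
Variables (n : nat) (m : 'rV[R]_n.+2) (q : 'rV[R]_(n.+2.*2)).

Definition change_of_basis : 'M[R]_(4 + n.*2) :=
  let B : 'M[R]_(4 + n.*2, 4) := symmetry_mx q in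
  block_mx (usubmx B) 0 (dsubmx B) 1%:M.

Definition reduced_jacobian : 'M[R]_(n.*2) :=
  let J : 'M[R]_(4 + n.*2) := cc_jacobian m q in
  drsubmx (invmx change_of_basis *m J *m change_of_basis).

Definition nondegenerate_cc : Prop := \det reduced_jacobian != 0.

End Nondegeneracy.

Definition lagrange_triangle : 'rV[R]_(3.*2) :=
  \row_(k < 3.*2) [:: 1; 0;
                      - (1 / 2); Num.sqrt 3 / 2;
                      - (1 / 2); - (Num.sqrt 3 / 2)]`_k.

End PlanarNBody.

Arguments lagrange_triangle R : clear implicits.

(* Main.v *)
(* Write t_ij(h) = <q_i - q_j, h_i - h_j> for the first-order stretch of a side.
   At an equilateral configuration of side l the variations of U, I and c
   combine so that the derivative of F_i in the direction h is
     3 / l^5 * sum_(j != i) m_i m_j (tau(h) - t_ij(h)) (q_j - q_i),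
   where tau is the mean of the t_ij with weights m_i m_j. If J2 w = 0, then
   the vector h = (0, w) fixes bodies 1 and 2 and Jac(F) h is the value of an
   infinitesimal symmetry. The forces above have no net force, torque or virial,
   so this symmetry vanishes; as two sides at a vertex are independent, all t_ij
   equal tau. Since t_12 = 0, body 3 does not move to first order along its two
   sides, and w = 0. *)
Require Import Defs.
From HB Require Import structures.
From mathcomp Require Import all_boot all_order all_algebra.
From mathcomp Require Import all_classical all_reals all_analysis.
From mathcomp Require Import ring lra.
Set Implicit Arguments. Unset Strict Implicit. Unset Printing Implicit Defensive.
Import Order.TTheory GRing.Theory Num.Theory.
Import numFieldNormedType.Exports.
Local Open Scope ring_scope.

(** * Differentiation rules for functions written pointwise *)

Lemma is_diff_sum_fun (R : realType) (V W : normedModType R) (I : Type)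
    (r : seq I) (P : pred I) (f df : I -> V -> W) (x : V) :
    (forall i, P i -> is_diff x (f i) (df i)) ->
  is_diff x (fun y => \sum_(i <- r | P i) f i y)
            (fun h => \sum_(i <- r | P i) df i h).
Proof.
move=> fP; elim: r => [|i r IH].
  under eq_fun do rewrite big_nil.
  under [X in is_diff _ _ X]eq_fun do rewrite big_nil.
  exact: is_diff_cst.
under eq_fun do rewrite big_cons.
under [X in is_diff _ _ X]eq_fun do rewrite big_cons.
have [Pi|//] := boolP (P i).
by apply: is_diffD => //; exact: fP.
Qed.

Lemma is_diff_scale_fun (R : realType) (V W : normedModType R) (f df : V -> R)
    (w : W) (x : V) :
  is_diff x f df -> is_diff x (fun y => f y *: w) (fun h => df h *: w).
Proof.
by move=> fx; apply: (@is_diff_comp _ _ _ _ f df ( *:%R ^~ w) ( *:%R ^~ w)).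
Qed.

Lemma is_diff_mul_fun (R : realType) (V : normedModType R) (f g df dg : V -> R)
    (x : V) :
    is_diff x f df -> is_diff x g dg ->
  is_diff x (fun y => f y * g y) (fun h => f x * dg h + g x * df h).
Proof. by move=> fx gx; exact: is_diffM. Qed.

Lemma is_diff_mull_fun (R : realType) (V : normedModType R) (f df : V -> R)
    (k : R) (x : V) :
  is_diff x f df -> is_diff x (fun y => k * f y) (fun h => k * df h).
Proof. by move=> fx; exact: (is_diffZ k fx). Qed.

Lemma is_diff_inv_fun (R : realType) (V : normedModType R) (f df : V -> R)
    (x : V) :
    is_diff x f df -> f x != 0 ->
  is_diff x (fun y => (f y)^-1) (fun h => - df h / f x ^+ 2).
Proof.
move=> fx fx0; split; first by apply: differentiableV => //; exact: ex_diff.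
rewrite diffV //; apply/funext => h /=.
by rewrite (@diff_val _ _ _ _ _ _ _ fx) /GRing.scale/= mulNr mulrC mulNr.
Qed.

Lemma is_diff_sqrt_fun (R : realType) (V : normedModType R) (f df : V -> R)
    (x : V) :
    is_diff x f df -> 0 < f x ->
  is_diff x (fun y => Num.sqrt (f y)) (fun h => df h / (2 * Num.sqrt (f x))).
Proof.
move=> fx fx0.
have sx : is_diff (f x) (@Num.sqrt R) (fun h => h / (2 * Num.sqrt (f x))).
  have [sD sE] := is_derive1_sqrt fx0.
  split; first exact/derivable1_diffP.
  by rewrite diff1E ?derive1E ?sE //; exact/derivable1_diffP.
exact: (is_diff_comp _ sx).
Qed.

Lemma is_diff_coord (R : realType) m n (i : 'I_m) (j : 'I_n) (x : 'M[R]_(m, n)) :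
  is_diff x (fun y : 'M[R]_(m, n) => y i j) (fun h => h i j).
Proof.
have lin : linear (fun y : 'M[R]_(m, n) => y i j : R^o).
  by move=> k u v; rewrite !mxE.
(* [diff_lin] applies to bundled linear maps, so the coordinate function is packed with its
   linearity proof. *)
pose fM := GRing.isLinear.Build _ _ _ _ _ lin.
pose f : {linear 'M[R]_(m, n) -> R^o} := HB.pack (fun y : 'M[R]_(m, n) => y i j) fM.
split; first exact: differentiable_coord.
exact: (@diff_lin _ _ _ f _ (@coord_continuous _ _ _ i j)).
Qed.

(** Expanding in the basis [delta_mx 0 k] reduces vector-valued maps to scalar ones. *)
Lemma is_diff_row (R : realType) (V : normedModType R) n (f df : V -> 'rV[R]_n)
    (x : V) :
    (forall k, is_diff x (fun y => f y 0 k) (fun h => df h 0 k)) ->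
  is_diff x f df.
Proof.
move=> fx.
rewrite (_ : f = fun y => \sum_k f y 0 k *: delta_mx 0 k); last first.
  by apply/funext => y; exact: row_sum_delta.
rewrite (_ : df = fun y => \sum_k df y 0 k *: delta_mx 0 k); last first.
  by apply/funext => y; exact: row_sum_delta.
by apply: is_diff_sum_fun => k _; exact: is_diff_scale_fun.
Qed.

Lemma is_diff_jacobian (R : realType) n p (f df : 'rV[R]_n -> 'rV[R]_p)
    (q h : 'rV[R]_n) :
  is_diff q f df -> h *m jacobian f q = df h.
Proof. by move=> fq; rewrite mul_rV_lin1/= diff_val. Qed.

Lemma is_diff_ext (R : realType) (V : normedModType R) (f df dg : V -> R) (x : V) :
  is_diff x f df -> df =1 dg -> is_diff x f dg.
Proof. by move=> fx /funext <-. Qed.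

Lemma is_diff_exp_fun (R : realType) (V : normedModType R) (f df : V -> R)
    (k : nat) (x : V) :
    is_diff x f df ->
  is_diff x (fun y => f y ^+ k.+1) (fun h => k.+1%:R * f x ^+ k * df h).
Proof. by move=> fx; have := is_diffX k fx; rewrite exprfctE. Qed.

Lemma is_diff_entry (R : realType) (V : normedModType R) n
    (f df : V -> 'rV[R]_n) (x : V) (k : 'I_n) :
  is_diff x f df -> is_diff x (fun y => f y 0 k) (fun h => df h 0 k).
Proof.
move=> fx.
exact: (is_diff_comp fx (is_diff_coord 0 k (f x))).
Qed.

Lemma is_diff_scaleM (R : realType) (V : normedModType R) n
    (f df : V -> R) (g dg : V -> 'rV[R]_n) (x : V) :
    is_diff x f df -> is_diff x g dg ->
  is_diff x (fun y => f y *: g y) (fun h => f x *: dg h + df h *: g x).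
Proof.
move=> fx gx; apply: is_diff_row => k.
under eq_fun do rewrite mxE.
under [X in is_diff _ _ X]eq_fun do rewrite !mxE [_ * g x _ _]mulrC.
exact/is_diff_mul_fun/is_diff_entry.
Qed.

(** In finite dimension each coordinate of a linear map is a finite combination of input
    coordinates, so no separate continuity argument arises. *)
Lemma is_diff_linear_rV (R : realType) m n (f : 'rV[R]_m -> 'rV[R]_n) (x : 'rV[R]_m) :
  linear f -> is_diff x f f.
Proof.
move=> lin.
pose fM := GRing.isLinear.Build _ _ _ _ _ lin.
pose g : {linear 'rV[R]_m -> 'rV[R]_n} := HB.pack f fM.
apply: is_diff_row => k.
have fE y : f y 0 k = \sum_j y 0 j * f (delta_mx 0 j) 0 k.
  rewrite -[f y]/(g y) [in LHS](row_sum_delta y) linear_sum summxE.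
  by apply: eq_bigr => j _; rewrite linearZ mxE.
under eq_fun do rewrite fE.
apply: is_diff_sum_fun => j _.
exact/(@is_diff_scale_fun _ _ R^o)/is_diff_coord.
Qed.

(** * Euclidean inner product and norm in the plane *)

Section PlanarVectors.
Variable R : realType.
Implicit Types u v : 'rV[R]_2.

Definition dot u v : R := \sum_(a < 2) u 0 a * v 0 a.

Lemma dotE u v : dot u v = u 0 0 * v 0 0 + u 0 1 * v 0 1.
Proof.
rewrite /dot big_ord_recl big_ord1; congr (_ * _ + u 0 _ * v 0 _); exact/val_inj.
Qed.

Lemma enormE v : enorm v = Num.sqrt (dot v v).
Proof. by congr Num.sqrt; apply: eq_bigr => a _; rewrite expr2. Qed.

Lemma enorm_ge0 v : 0 <= enorm v.
Proof. exact: sqrtr_ge0. Qed.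

Lemma enorm_sqr v : enorm v ^+ 2 = dot v v.
Proof. by rewrite enormE sqr_sqrtr // sumr_ge0 // => a _; exact: sqr_ge0. Qed.

Lemma is_diff_dot (V : normedModType R) (f df : V -> 'rV[R]_2) (x : V) :
    is_diff x f df ->
  is_diff x (fun y => dot (f y) (f y)) (fun h => 2 * dot (f x) (df h)).
Proof.
move=> fx; apply: (@is_diff_ext _ _ _ (fun h => \sum_(a < 2)
    (f x 0 a * df h 0 a + f x 0 a * df h 0 a))).
  by apply: is_diff_sum_fun => a _; apply: is_diff_mul_fun; exact: is_diff_entry.
by move=> h; rewrite big_split/= mulr_natl.
Qed.

Lemma is_diff_enorm (V : normedModType R) (f df : V -> 'rV[R]_2) (x : V) :
    is_diff x f df -> enorm (f x) != 0 ->
  is_diff x (fun y => enorm (f y)) (fun h => dot (f x) (df h) / enorm (f x)).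
Proof.
move=> fx fx0.
have dot_gt0 : 0 < dot (f x) (f x).
  by rewrite -enorm_sqr exprn_gt0 // lt_neqAle eq_sym fx0 enorm_ge0.
under eq_fun do rewrite enormE.
have sx := is_diff_sqrt_fun (is_diff_dot fx) dot_gt0.
apply: (is_diff_ext sx).
by move=> h; rewrite -enormE -mulf_div divff ?mul1r // pnatr_eq0.
Qed.

End PlanarVectors.

(** * The differential of F at a collision-free configuration *)

Section Differential.
Variables (R : realType) (N : nat) (m : 'rV[R]_N) (q : 'rV[R]_(N.*2)).
Implicit Types (p h : 'rV[R]_(N.*2)) (i j : 'I_N).

Definition relpos p i j : 'rV[R]_2 := position p i - position p j.

Lemma position_is_linear i : linear (fun p => position p i).
Proof. by move=> k u v; apply/rowP => a; rewrite !mxE. Qed.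

Lemma mass_center_is_linear : linear (mass_center m).
Proof.
move=> k u v; rewrite /mass_center scalerA mulrC -scalerA -scalerDr; congr (_ *: _).
rewrite scaler_sumr -big_split; apply: eq_bigr => i _ /=.
by rewrite position_is_linear scalerDr !scalerA mulrC.
Qed.

Lemma is_diff_position i :
  is_diff q (fun p => position p i) (fun h => position h i).
Proof. exact/is_diff_linear_rV/position_is_linear. Qed.

Lemma is_diff_relpos i j :
  is_diff q (fun p => relpos p i j) (fun h => relpos h i j).
Proof. by apply: is_diffB; exact: is_diff_position. Qed.

Lemma is_diff_mass_center : is_diff q (mass_center m) (mass_center m).
Proof. exact/is_diff_linear_rV/mass_center_is_linear. Qed.

Lemma is_diff_rel_center i :
  is_diff q (fun p => position p i - mass_center m p)
            (fun h => position h i - mass_center m h).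
Proof. exact: (is_diffB (is_diff_position i) is_diff_mass_center). Qed.

(** Each summand contains the differential of 1/r for r = |q_i - q_j|, namely -<q_i - q_j, h_i -
    h_j> / r^3. *)
Definition dpotential h : R :=
  \sum_(i < N) \sum_(j < N | (i < j)%N) m 0 i * m 0 j *
    - (dot (relpos q i j) (relpos h i j) / enorm (relpos q i j) ^+ 3).

Definition dinertia h : R :=
  \sum_(i < N) m 0 i * (2 * dot (position q i - mass_center m q)
                                (position h i - mass_center m h)).

(** Product rule in every term of F_i: the factor -3 / r^5 comes from differentiating r^-3, and the
    last quotient is the differential of U / I. *)
Definition dcc_map_body h i : 'rV[R]_2 :=
  \sum_(j < N | j != i)
     ((m 0 i * m 0 j / enorm (relpos q j i) ^+ 3) *: relpos h j i
      + (m 0 i * m 0 j * - (3 * dot (relpos q j i) (relpos h j i)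
            / enorm (relpos q j i) ^+ 5)) *: relpos q j i)
  + ((potential m q / inertia m q * m 0 i) *: (position h i - mass_center m h)
     + ((dpotential h * inertia m q - potential m q * dinertia h)
          / inertia m q ^+ 2 * m 0 i) *: (position q i - mass_center m q)).

Hypothesis noncollision : forall i j, i != j -> enorm (relpos q i j) != 0.

Lemma is_diff_potential : is_diff q (potential m) dpotential.
Proof.
apply: is_diff_sum_fun => i _; apply: is_diff_sum_fun => j ij.
have r0 : enorm (relpos q i j) != 0.
  by apply: noncollision; rewrite -val_eqE/= ltn_eqF.
apply: is_diff_mull_fun.
apply: (is_diff_ext (is_diff_inv_fun (is_diff_enorm (is_diff_relpos i j) r0) r0)).
by move=> h /=; field.
Qed.

Lemma is_diff_inertia : is_diff q (inertia m) dinertia.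
Proof.
apply: is_diff_sum_fun => i _; apply: is_diff_mull_fun.
under eq_fun do rewrite enorm_sqr.
exact/is_diff_dot/is_diff_rel_center.
Qed.

Lemma is_diff_cc_map_body i : inertia m q != 0 ->
  is_diff q (fun p => cc_map_body m p i) (fun h => dcc_map_body h i).
Proof.
move=> I0; apply: is_diffD.
  apply: is_diff_sum_fun => j ji.
  have r0 := noncollision ji.
  apply: (is_diff_scaleM _ (is_diff_relpos j i)).
  apply: is_diff_mull_fun.
  have r30 : enorm (relpos q j i) ^+ 3 != 0 by rewrite expf_neq0.
  have rD := is_diff_exp_fun 2 (is_diff_enorm (is_diff_relpos j i) r0).
  apply: (is_diff_ext (is_diff_inv_fun rD r30)).
  by move=> h /=; field.
apply: (is_diff_scaleM _ (is_diff_rel_center i)).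
have UI := is_diff_mul_fun is_diff_potential (is_diff_inv_fun is_diff_inertia I0).
under eq_fun do rewrite mulrC.
under [X in is_diff _ _ X]eq_fun do rewrite mulrC.
apply: is_diff_mull_fun; apply: (is_diff_ext UI).
by move=> h /=; field.
Qed.

Lemma is_diff_cc_map : inertia m q != 0 ->
  is_diff q (cc_map m) (fun h => interleave (dcc_map_body h)).
Proof.
move=> I0; apply: is_diff_row => k.
under eq_fun do rewrite mxE.
under [X in is_diff _ _ X]eq_fun do rewrite mxE.
exact/is_diff_entry/is_diff_cc_map_body.
Qed.

End Differential.

(** * Sums over three bodies, and positions relative to the center of mass *)

Lemma big_ord3 (V : nmodType) (F : 'I_3 -> V) :
  \sum_(i < 3) F i = F 0 + F 1 + F 2%:R.
Proof.
rewrite !big_ord_recl big_ord0 addr0 addrA.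
by congr (F _ + F _ + F _); exact/val_inj.
Qed.

Lemma big_ord3_cond (V : nmodType) (P : pred 'I_3) (F : 'I_3 -> V) :
  \sum_(i < 3 | P i) F i = (if P 0 then F 0 else 0) + (if P 1 then F 1 else 0)
                           + (if P 2%:R then F 2%:R else 0).
Proof. by rewrite big_mkcond big_ord3. Qed.

Section CenterOfMass.
Variables (R : realType) (N : nat) (m : 'rV[R]_N).
Hypothesis mass_neq0 : \sum_(i < N) m 0 i != 0.

(** Writing p_i as the mass-weighted mean of N copies of itself turns the offset from the center
    into a mean of differences, the same vectors as in the pair forces. *)
Lemma rel_centerE (p : 'rV[R]_(N.*2)) i :
  position p i - mass_center m p
  = (\sum_(i < N) m 0 i)^-1 *: \sum_(j < N) m 0 j *: relpos p i j.
Proof.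
apply: (@scalerI _ _ (\sum_(i < N) m 0 i)) => //.
rewrite scalerBr !scalerA divff // !scale1r scaler_suml -sumrB.
by apply: eq_bigr => j _; rewrite scalerBr.
Qed.

End CenterOfMass.

(** * F and its differential at an equilateral triangle of side l *)

Section EquilateralTriangle.
Variables (R : realType) (m : 'rV[R]_3) (q : 'rV[R]_(3.*2)) (l : R).
Hypothesis m_gt0 : forall i, 0 < m 0 i.
Hypothesis l_gt0 : 0 < l.
Hypothesis equilateral : forall i j, i != j -> enorm (relpos q i j) = l.
Implicit Types (p h : 'rV[R]_(3.*2)) (i j : 'I_3).

Definition mass_pairs : R := m 0 0 * m 0 1 + m 0 0 * m 0 2%:R + m 0 1 * m 0 2%:R.

Definition stretch h i j : R := dot (relpos q i j) (relpos h i j).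

Definition mean_stretch h : R :=
  (m 0 0 * m 0 1 * stretch h 0 1 + m 0 0 * m 0 2%:R * stretch h 0 2%:R
   + m 0 1 * m 0 2%:R * stretch h 1 2%:R) / mass_pairs.

Lemma total_mass_gt0 : 0 < \sum_(i < 3) m 0 i.
Proof. by rewrite big_ord3 !addr_gt0. Qed.

Lemma mass_pairs_gt0 : 0 < mass_pairs.
Proof. by rewrite !addr_gt0 // mulr_gt0. Qed.

Lemma stretchC h i j : stretch h i j = stretch h j i.
Proof. by rewrite /stretch !dotE !mxE; ring. Qed.

(* Lagrange's identity, polarized. *)
Lemma inertia_pairing p h :
  \sum_(i < 3) m 0 i * dot (position p i - mass_center m p)
                           (position h i - mass_center m h)
  = (\sum_(i < 3) m 0 i)^-1 *
    (m 0 0 * m 0 1 * dot (relpos p 0 1) (relpos h 0 1)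
     + m 0 0 * m 0 2%:R * dot (relpos p 0 2%:R) (relpos h 0 2%:R)
     + m 0 1 * m 0 2%:R * dot (relpos p 1 2%:R) (relpos h 1 2%:R)).
Proof.
have M0 := lt0r_neq0 total_mass_gt0.
rewrite /relpos /mass_center; move: (position p) (position h) M0 => x y.
by rewrite !big_ord3 !dotE !mxE => M0; field.
Qed.

Lemma inertia_equilateral :
  inertia m q = mass_pairs * l ^+ 2 / \sum_(i < 3) m 0 i.
Proof.
rewrite /inertia; under eq_bigr do rewrite enorm_sqr.
rewrite inertia_pairing -!enorm_sqr !equilateral //.
rewrite /mass_pairs; ring.
Qed.

Lemma potential_equilateral : potential m q = mass_pairs / l.
Proof.
rewrite /potential big_ord3 !big_ord3_cond /= !equilateral //.
rewrite /mass_pairs; ring.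
Qed.

Lemma dinertia_equilateral h :
  dinertia m q h = 2 * mass_pairs * mean_stretch h / \sum_(i < 3) m 0 i.
Proof.
rewrite /dinertia; under eq_bigr do rewrite mulrCA.
rewrite -mulr_sumr inertia_pairing /mean_stretch /stretch.
have P0 := lt0r_neq0 mass_pairs_gt0; have M0 := lt0r_neq0 total_mass_gt0.
by field; apply/andP.
Qed.

Lemma dpotential_equilateral h :
  dpotential m q h = - (mass_pairs * mean_stretch h / l ^+ 3).
Proof.
rewrite /dpotential big_ord3 !big_ord3_cond /= !equilateral //.
rewrite /mean_stretch /stretch.
have P0 := lt0r_neq0 mass_pairs_gt0; have l0 := lt0r_neq0 l_gt0.
by field; apply/andP.
Qed.

Lemma inertia_neq0 : inertia m q != 0.
Proof.
by rewrite inertia_equilateral lt0r_neq0 // divr_gt0 ?total_mass_gt0 //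
  mulr_gt0 ?mass_pairs_gt0 ?exprn_gt0.
Qed.

(** U is [mass_pairs] / l and I is [mass_pairs] l^2 / M with M the total mass, so the pair sum
    cancels in U / I. *)
Lemma multiplier_equilateral :
  potential m q / inertia m q = (\sum_(i < 3) m 0 i) / l ^+ 3.
Proof.
rewrite potential_equilateral inertia_equilateral.
have P0 := lt0r_neq0 mass_pairs_gt0; have l0 := lt0r_neq0 l_gt0.
have M0 := lt0r_neq0 total_mass_gt0.
by field; rewrite M0 l0 P0.
Qed.

(** The factor M in the coefficient cancels the 1 / M of [rel_centerE]. A central term thus becomes
    a sum over pairs that can be merged termwise with the gravitational sum. *)
Lemma sum_rel_center (c : R) p i :
  (c * (\sum_(i < 3) m 0 i) * m 0 i) *: (position p i - mass_center m p)
  = - \sum_(j < 3 | j != i) (c * (m 0 i * m 0 j)) *: relpos p j i.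
Proof.
rewrite rel_centerE ?lt0r_neq0 ?total_mass_gt0 // scalerA.
rewrite mulrAC mulfK ?lt0r_neq0 ?total_mass_gt0 //.
rewrite (bigD1 i) //= {1}/relpos subrr scaler0 add0r scaler_sumr -sumrN.
apply: eq_bigr => j _.
by rewrite scalerA -mulrA -scalerN opprB.
Qed.

(** With multiplier M / l^3 the central term is the opposite of the attraction, pair by pair. *)
Lemma equilateral_central_configuration : central_configuration m q.
Proof.
split.
  move=> i j /equilateral; apply: contra_eq_neq => qij.
  by rewrite /relpos qij subrr enormE dotE !mxE !mulr0 addr0 sqrtr0 lt_eqF.
apply/rowP => k; rewrite mxE /cc_map_body multiplier_equilateral.
rewrite [_ / l ^+ 3]mulrC sum_rel_center -sumrB big1 => [|j ji]; first by rewrite !mxE.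
by rewrite [enorm _]equilateral // [_ / _]mulrC subrr.
Qed.

Lemma dcc_map_body_equilateral h i :
  dcc_map_body m q h i = \sum_(j < 3 | j != i)
    (3 / l ^+ 5 * (m 0 i * m 0 j) * (mean_stretch h - stretch h i j))
      *: relpos q j i.
Proof.
have P0 := lt0r_neq0 mass_pairs_gt0; have l0 := lt0r_neq0 l_gt0.
have M0 := lt0r_neq0 total_mass_gt0.
rewrite /dcc_map_body multiplier_equilateral.
rewrite [_ / l ^+ 3]mulrC sum_rel_center.
(* Of the coefficient 3, one unit comes from the variation of U and two from that of I. The factor M
   is kept apart so that [sum_rel_center] applies again. *)
have -> : (dpotential m q h * inertia m q - potential m q * dinertia m q h)
    / inertia m q ^+ 2 = - (3 * mean_stretch h / l ^+ 5) * \sum_(i < 3) m 0 i.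
  rewrite dpotential_equilateral inertia_equilateral potential_equilateral.
  rewrite dinertia_equilateral.
  by field; rewrite M0 l0 P0.
(* For each pair the two terms in [relpos h j i] cancel, as in the equation for q itself; only
   multiples of [relpos q j i] remain. *)
rewrite sum_rel_center addrA -!sumrB; apply: eq_bigr => j ji.
rewrite equilateral // -/(stretch h j i) stretchC.
apply/rowP => a; rewrite !mxE; field.
by rewrite l0.
Qed.

Lemma cc_jacobian_equilateral (h : 'cV[R]_(3.*2)) :
  cc_jacobian m q *m h = (interleave (dcc_map_body m q h^T))^T.
Proof.
rewrite /cc_jacobian -{1}[h]trmxK -trmx_mul.
have collisionless i j : i != j -> enorm (relpos q i j) != 0.
  by move=> ij; rewrite equilateral // lt0r_neq0.
by rewrite (is_diff_jacobian _ (is_diff_cc_map collisionless inertia_neq0)).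
Qed.

End EquilateralTriangle.

(** * A kernel criterion for nondegeneracy *)

Lemma big_ord4 (V : nmodType) (F : 'I_4 -> V) :
  \sum_(i < 4) F i = F 0 + F 1 + F 2%:R + F 3%:R.
Proof.
rewrite !big_ord_recl big_ord0 addr0 !addrA.
by congr (F _ + F _ + F _ + F _); exact/val_inj.
Qed.

Section Criterion.
Variable R : realType.

Lemma vec2_0 (x y : R) : vec2 x y 0 0 = x.
Proof. by rewrite mxE. Qed.

Lemma vec2_1 (x y : R) : vec2 x y 0 1 = y.
Proof. by rewrite mxE. Qed.

Lemma vec2E (v : 'rV[R]_2) : v = vec2 (v 0 0) (v 0 1).
Proof.
apply/rowP => -[[|[|//]] a2]; rewrite mxE /=; congr (v _ _); exact/val_inj.
Qed.

Lemma det_neq0_ker (F : fieldType) n (A : 'M[F]_n) :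
  (forall w : 'cV_n, A *m w = 0 -> w = 0) -> \det A != 0.
Proof.
move=> Ainj; rewrite -det_tr; apply/negP => /det0P[v v0 vA].
case/eqP: v0; apply: trmx_inj; rewrite trmx0; apply: Ainj.
by rewrite -[A]trmxK -trmx_mul vA trmx0.
Qed.

Lemma position_interleave N (v : 'I_N -> 'rV[R]_2) i :
  position (interleave v) i = v i.
Proof.
apply/rowP => a; rewrite !mxE; congr (v _ _ _); apply/val_inj => /=.
  by rewrite halfD odd_double doubleK; case: a => -[|[|//]] ? /=; rewrite addn0.
by rewrite inordK oddD odd_double; case: a => -[|[|//]].
Qed.

Lemma positionP N (p p' : 'rV[R]_(N.*2)) : position p =1 position p' -> p = p'.
Proof.
move=> pp; apply/rowP => k.
have /rowP/(_ (inord (odd k))) := pp (body_index k); rewrite !mxE.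
suff -> : coord_index (body_index k) (inord (odd k)) = k by [].
apply/val_inj; rewrite /= inordK; last by case: odd.
by rewrite addnC odd_double_half.
Qed.

(** Reads [symmetry_mx q *m u] as a velocity field: entries 0 and 1 of [u] are the translation,
    entry 2 the angular velocity, entry 3 the rate of dilation. *)
Lemma position_symmetry N (q : 'rV[R]_(N.*2)) (u : 'cV[R]_4) i :
  position (symmetry_mx q *m u)^T i =
  vec2 (u 0 0 - position q i 0 1 * u 2%:R 0 + position q i 0 0 * u 3%:R 0)
       (u 1 0 + position q i 0 0 * u 2%:R 0 + position q i 0 1 * u 3%:R 0).
Proof.
have entry c a : symmetry_mx q (coord_index i a) c = (nth 0
    [:: vec2 1 0; vec2 0 1; vec2 (- position q i 0 1) (position q i 0 0);
        position q i] c) 0 a.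
  rewrite mxE; case: c => -[|[|[|[|//]]]] ? /=; last by rewrite mxE.
  - by have /rowP/(_ a) := position_interleave (fun=> vec2 1 0) i; rewrite mxE.
  - by have /rowP/(_ a) := position_interleave (fun=> vec2 0 1) i; rewrite mxE.
  - have /rowP/(_ a) := position_interleave
      (fun i => vec2 (- position q i 0 1) (position q i 0 0)) i.
    by rewrite mxE.
apply/rowP => a; rewrite [LHS]mxE [LHS]mxE [LHS]mxE.
under eq_bigr do rewrite entry.
rewrite big_ord4.
case: a => -[|[|//]] a2.
  rewrite (_ : Ordinal a2 = 0); last exact/val_inj.
  by rewrite /= !mxE /=; ring.
rewrite (_ : Ordinal a2 = 1); last exact/val_inj.
by rewrite /= !mxE /=; ring.
Qed.

Section Nondegeneracy.
Variables (n : nat) (m : 'rV[R]_n.+2) (q : 'rV[R]_(n.+2.*2)).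

(** The top four rows are the coordinates of bodies 0 and 1. Since [4 + n.*2] and [n.+2.*2] are
    convertible, [position] can be applied to [v^T]. *)
Lemma usubmx_eq0 (v : 'cV[R]_(4 + n.*2)) :
  usubmx v = 0 <-> @position R n.+2 v^T 0 = 0 /\ @position R n.+2 v^T 1 = 0.
Proof.
have E (k : 'I_4) (i : 'I_n.+2) (a : 'I_2) : (k = i.*2 + a :> nat)%N ->
    usubmx v k 0 = @position R n.+2 v^T i 0 a.
  by move=> ki; rewrite !mxE; congr (v _ _); apply/val_inj.
split=> [v0|[v0 v1]].
  split; apply/rowP => -[[|[|//]] a2].
  - by rewrite -(E 0) ?v0 ?mxE.
  - by rewrite -(E 1) ?v0 ?mxE.
  - by rewrite -(E 2%:R) ?v0 ?mxE.
  - by rewrite -(E 3%:R) ?v0 ?mxE.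
apply/colP => -[[|[|[|[|//]]]] k4].
- by rewrite (E _ 0 0) // v0 !mxE.
- by rewrite (E _ 0 1) // v0 !mxE.
- by rewrite (E _ 1 0) // v1 !mxE.
- by rewrite (E _ 1 1) // v1 !mxE.
Qed.

(** A kernel vector w of J2 gives h = (0, w), which P fixes. The conjugated Jacobian sends h to (J1
    w, 0), and P sends that to B J1 w, a value of an infinitesimal symmetry. *)
Lemma nondegenerate_ccP :
    position q 0 != position q 1 ->
    (forall (h : 'cV[R]_(n.+2.*2)) (u : 'cV[R]_4),
        position h^T 0 = 0 -> position h^T 1 = 0 ->
        cc_jacobian m q *m h = symmetry_mx q *m u -> h = 0) ->
  nondegenerate_cc m q.
Proof.
move=> q01 Jker; rewrite /nondegenerate_cc /reduced_jacobian.
pose B : 'M[R]_(4 + n.*2, 4) := symmetry_mx q.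
set P := change_of_basis q.
pose J : 'M[R]_(4 + n.*2) := cc_jacobian m q.
have Punit : P \in unitmx.
  (* P is block lower triangular with an identity block, so it is enough that B1 be injective: a
     symmetry fixing two distinct points is zero. *)
  rewrite unitmxE unitfE det_lblock det1 mulr1.
  apply: det_neq0_ker => u; rewrite mul_usub_mx.
  move=> /usubmx_eq0[]; rewrite !position_symmetry.
  set x := position q 0; set y := position q 1.
  have xy0 : (x 0 0 - y 0 0) ^+ 2 + (x 0 1 - y 0 1) ^+ 2 != 0.
    rewrite paddr_eq0 ?sqr_ge0 // !sqrf_eq0 !subr_eq0.
    apply: contra_neqN q01 => /andP[/eqP xy0 /eqP xy1].
    by rewrite -/x -/y (vec2E x) (vec2E y) xy0 xy1.
  move=> /rowP px /rowP py.
  have := px 0; have := px 1; have := py 0; have := py 1.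
  have zeroE a : (0 : 'rV[R]_2) 0 a = 0 by rewrite mxE.
  rewrite !vec2_0 !vec2_1 !zeroE => py1 py0 px1 px0.
  set dx := x 0 0 - y 0 0 in xy0; set dy := x 0 1 - y 0 1 in xy0.
  (* Subtracting the equations of the two bodies eliminates the translation. The remaining system in
     rotation and dilation has determinant dx^2 + dy^2 up to sign. *)
  have e0 : dx * u 3%:R 0 - dy * u 2%:R 0 = 0 by rewrite /dx /dy; lra.
  have e1 : dx * u 2%:R 0 + dy * u 3%:R 0 = 0 by rewrite /dx /dy; lra.
  have u2 : u 2%:R 0 = 0.
    apply: (mulIf xy0).
    transitivity (dx * (dx * u 2%:R 0 + dy * u 3%:R 0)
                  - dy * (dx * u 3%:R 0 - dy * u 2%:R 0)); first by ring.
    by rewrite e0 e1; ring.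
  have u3 : u 3%:R 0 = 0.
    apply: (mulIf xy0).
    transitivity (dy * (dx * u 2%:R 0 + dy * u 3%:R 0)
                  + dx * (dx * u 3%:R 0 - dy * u 2%:R 0)); first by ring.
    by rewrite e0 e1; ring.
  move: px0 px1; rewrite u2 u3 !mulr0 subr0 !addr0 => u0 u1.
  apply/colP => -[[|[|[|[|//]]]] k4]; rewrite mxE.
  - by rewrite -[RHS]u0; congr (u _ _); exact/val_inj.
  - by rewrite -[RHS]u1; congr (u _ _); exact/val_inj.
  - by rewrite -[RHS]u2; congr (u _ _); exact/val_inj.
  - by rewrite -[RHS]u3; congr (u _ _); exact/val_inj.
apply: det_neq0_ker => w Kw.
set h : 'cV[R]_(4 + n.*2) := col_mx 0 w.
pose K := invmx P *m J *m P.
have Ph : P *m h = h.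
  by rewrite mul_block_col !mulmx0 mul0mx mul1mx !add0r.
have Kh : K *m h = col_mx (ursubmx K *m w) 0.
  by rewrite -{1}[K]submxK mul_block_col !mulmx0 !add0r; congr col_mx.
have Jh : J *m h = B *m (ursubmx K *m w).
  have -> : J *m h = P *m (K *m h) by rewrite /K -!mulmxA Ph mulKVmx.
  rewrite Kh mul_block_col !mulmx0 !addr0 -mul_col_mx.
  by rewrite vsubmxK.
have [h0 h1] := (usubmx_eq0 h).1 (col_mxKu _ _).
by rewrite -(col_mxKd (0 : 'cV_4) w) -/h [h](Jker _ _ h0 h1 Jh) linear0.
Qed.

End Nondegeneracy.
End Criterion.

(** * The Lagrange triangle, with side sqrt 3 *)

Section LagrangeTriangle.
Variable R : realType.
Local Notation q := (lagrange_triangle R).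
Local Notation s := (Num.sqrt (3 : R)).

Lemma sqr_sqrt3 : s * s = 3.
Proof. by rewrite -expr2 sqr_sqrtr. Qed.

Lemma lagrange_position (i : 'I_3) :
  position q i = vec2 [:: 1; - (1 / 2); - (1 / 2)]`_i [:: 0; s / 2; - (s / 2)]`_i.
Proof.
apply/rowP => a; rewrite !mxE.
by case: i a => -[|[|[|//]]] ? [[|[|//]] ?].
Qed.

Lemma lagrange_equilateral (i j : 'I_3) : i != j -> enorm (relpos q i j) = s.
Proof.
have s2 := sqr_sqrt3.
rewrite enormE dotE /relpos !lagrange_position => ij; congr Num.sqrt.
rewrite !mxE; case: i j ij => -[|[|[|//]]] ? [[|[|[|//]]] ?] //= _; nra.
Qed.

(** This is the kernel condition of [nondegenerate_ccP], checked in coordinates as a linear system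
    in three pair coefficients and four symmetry parameters. *)
Lemma lagrange_kernel (m : 'rV[R]_3) (h : 'cV[R]_(3.*2)) (u : 'cV[R]_4) :
    (forall i, 0 < m 0 i) ->
    position h^T 0 = 0 -> position h^T 1 = 0 ->
  cc_jacobian m q *m h = symmetry_mx q *m u -> h = 0.
Proof.
move=> m_gt0 h0 h1 Jh; have s2 := sqr_sqrt3.
have s_gt0 : 0 < s by rewrite sqrtr_gt0.
pose f (i j : 'I_3) := 3 / s ^+ 5 * (m 0 i * m 0 j)
  * (mean_stretch m q h^T - stretch q h^T i j).
have fC i j : f i j = f j i.
  by rewrite /f stretchC [m 0 i * _]mulrC.
have balance i : \sum_(j < 3 | j != i) f i j *: relpos q j i =
    position (symmetry_mx q *m u)^T i.
  rewrite -Jh (cc_jacobian_equilateral m_gt0 s_gt0 lagrange_equilateral) trmxK.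
  rewrite position_interleave.
  by rewrite (dcc_map_body_equilateral m_gt0 s_gt0 lagrange_equilateral).
(* Deviations from a weighted mean have weighted sum zero. As all sides are equal, this says that
   the virial vanishes. *)
have f_sum : f 0 1 + f 0 2%:R + f 1 2%:R = 0.
  have := lt0r_neq0 (mass_pairs_gt0 m_gt0).
  rewrite /f /mean_stretch /mass_pairs => P0; field.
  by rewrite P0 lt0r_neq0.
have [f01 [f02 f12]] : f 0 1 = 0 /\ f 0 2%:R = 0 /\ f 1 2%:R = 0.
  have coord i a := congr1 (fun v : 'rV[R]_2 => v 0 a) (balance i).
  have := coord 0 0; have := coord 0 1; have := coord 1 0; have := coord 1 1.
  have := coord 2%:R 0; have := coord 2%:R 1.
  rewrite !position_symmetry !big_ord3_cond /= /relpos !lagrange_position /=.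
  rewrite !mxE /=.
  rewrite (fC 1 0) (fC 2%:R 0) (fC 2%:R 1).
  move: (f 0 1) (f 0 2%:R) (f 1 2%:R) f_sum => A B C ABC.
  move: s s2 s_gt0 => r r2 r_gt0 y2 x2 y1 x1 y0 x0.
  (* The y-equations sum to 3 [u 1 0] = 0. Comparing [x1] with [x2] gives A = B and removes the
     rotation; then [f_sum] gives C = -2A, and [y1] forces A = 0. *)
  have u1 : u 1 0 = 0 by lra.
  have u2 : u 2%:R 0 = r * (A - B) / 2 by lra.
  (* The product r * r = 3 is supplied by hand, since [lra] treats nonlinear monomials as atoms. *)
  have ru2 : r * u 2%:R 0 = 3 * (A - B) / 2 by rewrite u2 -r2; ring.
  have AB : A = B by lra.
  have u3 : u 3%:R 0 = - 3 * A by lra.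
  have C2 : C = - 2 * A by lra.
  have rA : r * A = 0 by move: y1; rewrite u1 u2 u3 C2 -AB; lra.
  have A0 : A = 0 by move/eqP: rA; rewrite mulf_eq0 gt_eqF //= => /eqP.
  by split; [|split]; lra.
have f_eq0 i j : f i j = 0 -> stretch q h^T i j = mean_stretch m q h^T.
  move/eqP; rewrite mulf_eq0 gt_eqF ?mulr_gt0 ?divr_gt0 ?exprn_gt0 //=.
  by rewrite subr_eq0 => /eqP.
have h01 : stretch q h^T 0 1 = 0.
  by rewrite /stretch /relpos h0 h1 dotE !mxE; ring.
(* Bodies 0 and 1 do not move, so the common stretch is that of a fixed side. *)
have tau0 : mean_stretch m q h^T = 0 by rewrite -(f_eq0 _ _ f01).
have h2 : position h^T 2%:R = 0.
  have := f_eq0 _ _ f02; have := f_eq0 _ _ f12.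
  rewrite tau0 /stretch /relpos h0 h1 !lagrange_position !sub0r.
  move: (position h^T 2%:R) => v; rewrite !dotE.
  have vN a : (- v) 0 a = - v 0 a by rewrite mxE.
  rewrite !vN {vN} !mxE /= => e12 e02.
  (* The side between bodies 1 and 2 is vertical and fixes the second coordinate; the side from body
     0 then fixes the first. *)
  have sv : s * v 0 1 = 0 by lra.
  have v1 : v 0 1 = 0 by move/eqP: sv; rewrite mulf_eq0 gt_eqF //= => /eqP.
  have v0 : v 0 0 = 0 by lra.
  by rewrite (vec2E v) v0 v1; apply/rowP => -[[|[|//]] ?]; rewrite !mxE.
apply: trmx_inj; rewrite trmx0; apply: positionP => i.
have -> : position 0 i = 0 :> 'rV[R]_2 by apply/rowP => a; rewrite !mxE.
case: i => -[|[|[|//]]] ?.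
- by rewrite -[RHS]h0; congr position; exact/val_inj.
- by rewrite -[RHS]h1; congr position; exact/val_inj.
- by rewrite -[RHS]h2; congr position; exact/val_inj.
Qed.

End LagrangeTriangle.

Theorem proposition3p18 (R : realType) (m0 : 'rV[R]_3)
    (hm0 : forall i : 'I_3, 0 < m0 0 i) :
  central_configuration m0 (lagrange_triangle R) /\ nondegenerate_cc m0 (lagrange_triangle R).
Proof.
have s_gt0 : 0 < Num.sqrt (3 : R) by rewrite sqrtr_gt0.
have cc := equilateral_central_configuration hm0 s_gt0 (@lagrange_equilateral R).
split=> //; apply: nondegenerate_ccP; first exact: cc.1.
by move=> h u; exact: lagrange_kernel.
Qed.
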